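(* Let $P_1,\ldots,P_n$ be countable meet-continuous dcpos. Suppose that, for each $i$ and each $r\in P_i$, every nonempty subset of $\mathord{\downarrow}r$ has a supremum in $\mathord{\downarrow}r$. Then \[ \sigma\Bigl(\prod_{i=1}^{n}P_i\Bigr)=\prod_{i=1}^{n}\sigma(P_i). \] Neither global least elements nor least elements of the principal ideals are required.
   Context: All posets and directed sets are nonempty; countable sets may be finite. A subset $D$ of a poset is directed if any two of its elements have a common upper bound in $D$. A dcpo is a poset in which every directed subset has a supremum. Write $\mathord{\downarrow}x=\{y:y\le x\}$ (a principal ideal) and $\mathord{\downarrow}A=\bigcup_{a\in A}\mathord{\downarrow}a$. A supremum in $\mathord{\downarrow}r$ means a least upper bound computed in the poset $\mathord{\downarrow}r$ with its induced order. For a dcpo $P$, an upper set $U\subseteq P$ is Scott open if for every directed $D\subseteq P$, $\bigvee D\in U$ implies $D\cap U\neq\emptyset$; the Scott open sets form the Scott topology $\sigma(P)$. A dcpo $P$ is meet-continuous if for every $x\in P$ and every directed $D\subseteq P$, $x\le\bigvee D$ implies $x\in\operatorname{cl}_{\sigma(P)}(\mathord{\downarrow}x\cap\mathord{\downarrow}D)$, where $\operatorname{cl}_{\sigma(P)}$ is closure in the Scott topology. $\prod_i P_i$ carries the coordinatewise order, $\sigma(\prod_i P_i)$ is its Scott topology, and $\prod_i\sigma(P_i)$ denotes the ordinary topological product of the Scott topologies. *)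

(* Defs.v *)
From HB Require Import structures.
From mathcomp Require Import all_boot all_order.
From mathcomp Require Import all_classical.
From mathcomp Require Import topology.

Set Implicit Arguments.
Unset Strict Implicit.
Unset Printing Implicit Defensive.

Import Order.TTheory.
Local Open Scope classical_set_scope.
Local Open Scope order_scope.

Section Dcpo.
Context {d : Order.disp_t} (P : porderType d).

Definition directed (D : set P) : Prop :=
  D !=set0 /\
  forall x y, D x -> D y -> exists z, [/\ D z, x <= z & y <= z].

Definition dcpo : Prop :=
  forall D : set P, directed D -> exists s, isLub D s.

(* [\/D \in U] is read relationally, "every least upper bound of D lies in U";
   in a dcpo a directed set has exactly one. *)
Definition scott_open (U : set P) : Prop :=
  (forall x y, U x -> x <= y -> U y) /\
  (forall (D : set P) (s : P),
     directed D -> isLub D s -> U s -> D `&` U !=set0).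

Lemma scott_openT : scott_open [set: P].
Proof. by split=> // D s [[x Dx] _] _ _; exists x. Qed.

Lemma scott_openI : setI_closed scott_open.
Proof.
move=> U V [Uup US] [Vup VS]; split=> [x y [Ux Vx] xy|D s Ddir Ds [Us Vs]].
  by split; [exact: Uup xy|exact: Vup xy].
have [x [Dx Ux]] := US _ _ Ddir Ds Us; have [y [Dy Vy]] := VS _ _ Ddir Ds Vs.
have [z [Dz xz yz]] := Ddir.2 _ _ Dx Dy.
by exists z; split=> //; split; [exact: Uup xz|exact: Vup yz].
Qed.

Lemma scott_open_bigU (I : Type) (f : I -> set P) :
  (forall i, scott_open (f i)) -> scott_open (\bigcup_i f i).
Proof.
move=> fo; split=> [x y [i _ fix_] xy|D s Ddir Ds [i _ fis]].
  by exists i => //; exact: (fo i).1 xy.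
by have [x [Dx fx]] := (fo i).2 _ _ Ddir Ds fis; exists x; split=> //; exists i.
Qed.

End Dcpo.

(* Alias of P carrying its Scott topology sigma(P). *)
Definition scott {d : Order.disp_t} (P : porderType d) : Type := P.

HB.instance Definition _ (d : Order.disp_t) (P : porderType d) :=
  Choice.on (scott P).
HB.instance Definition _ (d : Order.disp_t) (P : porderType d) :=
  isOpenTopological.Build (scott P)
    (@scott_openT d P) (@scott_openI d P) (@scott_open_bigU d P).

Definition scott_topology {d : Order.disp_t} (P : porderType d) : set (set P) :=
  @open (scott P).
Arguments scott_topology {d} P _.

Definition meet_continuous {d : Order.disp_t} (P : porderType d) : Prop :=
  forall (x : P) (D : set P) (s : P), directed D -> isLub D s -> x <= s ->
    closure ([set y : P | y <= x] `&` down D : set (scott P)) x.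

(* The principal ideal of r, with the order induced from P. *)
Definition pideal {d : Order.disp_t} {P : porderType d} (r : P) : Type :=
  {x : P | x <= r}.

HB.instance Definition _ (d : Order.disp_t) (P : porderType d) (r : P) :=
  SubChoice.on (pideal r).
HB.instance Definition _ (d : Order.disp_t) (P : porderType d) (r : P) :=
  [SubChoice_isSubPOrder of pideal r by <: with d].

(* The product of a family of posets, with the coordinatewise order. *)
Definition poset_prod {d : Order.disp_t} {I : Type} (P : I -> porderType d)
  : Type := forall i, P i.

Section PosetProd.
Context {d : Order.disp_t} {I : Type} (P : I -> porderType d).

HB.instance Definition _ := Choice.on (poset_prod P).

Definition prod_le (x y : poset_prod P) : bool := `[< forall i, x i <= y i >].

Lemma prod_le_refl : reflexive prod_le.
Proof. by move=> x; apply/asboolP. Qed.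

Lemma prod_le_anti : antisymmetric prod_le.
Proof.
move=> x y /andP[/asboolP xy /asboolP yx].
by apply: functional_extensionality_dep => i; apply: le_anti; rewrite xy yx.
Qed.

Lemma prod_le_trans : transitive prod_le.
Proof.
move=> y x z /asboolP xy /asboolP yz.
by apply/asboolP => i; exact: le_trans (xy i) (yz i).
Qed.

HB.instance Definition _ := Order.Le_isPOrder.Build d (poset_prod P)
  prod_le_refl prod_le_anti prod_le_trans.

End PosetProd.

Definition product_of_scott_topologies {d : Order.disp_t} {I : Type}
    (P : I -> porderType d) : set (set (poset_prod P)) :=
  @open (prod_topology (fun i => scott (P i))).
Arguments product_of_scott_topologies {d I} P _.

(* Main.v *)
(* For a Scott open U of the product and x in U, one enlarges the finite box {x}
   inside U, one coordinate of one point at a time, until each factor of the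
   box generates a Scott open set.  The obstacle is that a point may be the
   supremum of uncountably many ideals, all of which must meet the factor.
   A well-founded two-player game reduces "every ideal with supremum x through
   p meets the factor" to countably many requirements: x may be lowered within
   a Scott neighbourhood (meet-continuity restricts ideals to the lowered
   point) and p may be raised in reply to the ideal.  If some pair p <= x were
   not won, its interval would contain two disjoint intervals of the same kind,
   and the resulting Cantor scheme would make the dcpo uncountable. *)
Require Import Defs.
From mathcomp Require Import all_boot all_order.
From mathcomp Require Import all_classical.
From mathcomp Require Import topology.

Set Implicit Arguments.
Unset Strict Implicit.
Unset Printing Implicit Defensive.

Import Order.TTheory.
Local Open Scope classical_set_scope.
Local Open Scope order_scope.

(** * History-dependent choice and scheduling *)

Lemma course_of_values_choice (E : Type) (e0 : E) (good : set (seq E))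
    (next : seq E -> E -> Prop) :
  good [::] ->
  (forall l, good l -> exists e, good (rcons l e) /\ next l e) ->
  exists e : nat -> E, forall k, good (mkseq e k) /\ next (mkseq e k) (e k).
Proof.
move=> good0 goodS.
have /choice[g gP] l : exists e, good l -> good (rcons l e) /\ next l e.
  have [/goodS[e eP]|nl] := pselect (good l); first by exists e.
  by exists e0.
pose s := fix s k := if k is k'.+1 then rcons (s k') (g (s k')) else [::].
have sE k : mkseq (fun k => g (s k)) k = s k.
  by elim: k => // k IH; rewrite mkseqS IH.
have good_s k : good (s k) by elim: k => //= k /gP[].
exists (fun k => g (s k)) => k; rewrite sE; split=> //.
by case: (gP _ (good_s k)).
Qed.

(** Decode the exponent of 2 in [k.+1]; the odd cofactor is free, so each value recurs arbitrarily
    late. *)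
Lemma infinitely_repeating_enumeration (T : countType) :
  exists f : nat -> option T, forall t k, exists2 m, (k <= m)%N & f m = Some t.
Proof.
exists (fun k => unpickle (logn 2 k.+1)) => t k.
exists (2 ^ pickle t * k.*2.+1).-1%N.
  rewrite -ltnS prednK ?muln_gt0 ?expn_gt0 //.
  apply: (@leq_trans k.*2.+1); first by rewrite ltnS -addnn leq_addr.
  by rewrite leq_pmull // expn_gt0.
rewrite prednK ?muln_gt0 ?expn_gt0 // lognM ?expn_gt0 // pfactorK //.
by rewrite lognE /= dvdn2 /= odd_double addn0 pickleK.
Qed.

(** * Ideals and the descent game *)

Section Ideals.
Context {d : Order.disp_t} (P : porderType d).
Implicit Types (J : set P) (p u v x : P).

Definition ideal J := directed J /\ forall x y, J y -> x <= y -> J x.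

Lemma ideal_down (D : set P) : directed D -> ideal (down D).
Proof.
move=> [[x Dx] dirD]; split; last first.
  by move=> y z [w [Dw zw]] yz; exists w; split=> //; exact: le_trans zw.
split; first by exists x, x.
move=> y z [a [Da ya]] [b [Db zb]]; have [c [Dc ac bc]] := dirD _ _ Da Db.
by exists c; split; [exists c|exact: le_trans ac|exact: le_trans bc].
Qed.

Lemma isLub_down (D : set P) x : isLub D x -> isLub (down D) x.
Proof.
move=> [ubx lubx]; split=> [y [z [Dz yz]]|y uby].
  by apply: le_trans (ubx _ Dz).
by apply: lubx => z Dz; apply: uby; exists z.
Qed.

Lemma scott_open_nle u : @open (scott P) [set x | ~~ (x <= u)].
Proof.
split=> [x y xu xy|D s dirD [_ lubs] su].
  by apply: contra xu; exact: le_trans.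
apply: contrapT => no; move/negP: su; apply; apply: lubs => x Dx.
by apply: contrapT => /negP xu; apply: no; exists x.
Qed.

(* Binary suprema inside the principal ideal of a bound for J keep the
   intersection directed; meet-continuity then makes its supremum equal to v. *)
Lemma ideal_meet_principal (P_dcpo : dcpo P) (P_mc : meet_continuous P)
    (P_sups : forall (r : P) (A : set (pideal r)),
      A !=set0 -> exists s : pideal r, isLub A s)
    J u v : ideal J -> isLub J u -> v <= u ->
  ideal (J `&` [set x | x <= v]) /\ isLub (J `&` [set x | x <= v]) v.
Proof.
move=> [dirJ lowJ] lubJ vu.
have downJ : down J = J.
  apply/seteqP; split=> [x [y [Jy]]|x Jx]; first exact: lowJ.
  by exists x.
have cl := P_mc _ _ _ dirJ lubJ vu; rewrite downJ setIC in cl.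
have idl : ideal (J `&` [set x | x <= v]).
  split; last first.
    by move=> x y [Jy yv] xy; split; [exact: lowJ xy|exact: le_trans yv].
  split.
    have [|x [Jx _]] := cl setT; first exact: filterT.
    by exists x.
  move=> x y [Jx xv] [Jy yv].
  have [c [Jc xc yc]] := dirJ.2 _ _ Jx Jy.
  have cu : c <= u by exact: lubJ.1.
  pose A : set (pideal u) := [set z | val z = x \/ val z = y].
  have xu := le_trans xc cu; have yu := le_trans yc cu.
  have [|s [ubs lubs]] := P_sups u A.
    by exists (exist _ x xu); left.
  (* A supremum taken below [u] is compared only with bounds below [u]; [c] and [v] are such bounds,
     which puts it in [J] and below [v]. *)
  have bound w : w <= u -> x <= w -> y <= w -> val s <= w.
    move=> wu xw yw.
    suff : s <= (exist _ w wu : pideal u) by [].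
    by apply: lubs => z [] zE; rewrite -[z <= _]/(val z <= w) zE.
  exists (val s); split.
  - split; last exact: bound.
    by apply: lowJ Jc _; apply: bound.
  - exact: (ubs (exist _ x xu) (or_introl erefl)).
  - exact: (ubs (exist _ y yu) (or_intror erefl)).
split=> //.
have [s lubs] := P_dcpo _ idl.1.
have sv : s <= v by apply: lubs.2 => x [].
suff vs : v <= s by have {2}-> : v = s by apply/le_anti; rewrite vs.
(* Otherwise the points not below [s] form a Scott neighbourhood of [v], which must meet the ideal
   bounded by [s]. *)
apply: contrapT => vs.
have [|x [Jx /negP]] := cl [set x | ~~ (x <= s)].
  by apply: open_nbhs_nbhs; split; [exact: scott_open_nle|exact/negP].
by apply; exact: lubs.1.
Qed.

(** A well-founded tree of arbitrary branching: continuations depend on the new pair, not on the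
    neighbourhood or ideal that led to it. *)
Inductive strategy : Type := Stop | Play of (P -> P -> strategy).

(* A strategy at (p, x) moves x down to some u in any given Scott neighbourhood
   of x, still above p; the opponent answers with an ideal J with supremum u
   containing p; some p' in J then replaces p, and the play must end with the
   pair reduced to a single point. *)
Fixpoint wins (t : strategy) (p x : P) : Prop :=
  match t with
  | Stop => p = x
  | Play f => forall V : set (scott P), open V -> V x ->
      exists u, [/\ V u, p <= u, u <= x &
        forall J, ideal J -> isLub J u -> J p ->
          exists2 p', J p' & wins (f p' u) p' u]
  end.

Definition lost p x := p <= x /\ forall t, ~ wins t p x.

(** Otherwise, winning strategies for the pairs reached, chosen once for all pairs, glue into one
    [Play] that wins at [(p, x)]. *)
Lemma lost_ideal p x : lost p x ->
  exists V : set (scott P), [/\ open V, V x & forall u, V u -> p <= u -> u <= x ->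
    exists J, [/\ ideal J, isLub J u, J p & forall q, J q -> lost q u]].
Proof.
move=> [px nwin].
have /choice[f fP] (qu : P * P) : exists t, ~ lost qu.1 qu.2 -> qu.1 <= qu.2 ->
    wins t qu.1 qu.2.
  have [[t tP]|no] := pselect (exists t, wins t qu.1 qu.2); first by exists t.
  exists Stop => nlost le; exfalso; apply: nlost; split=> // t tw.
  by apply: no; exists t.
apply: contrapT => no; apply: (nwin (Play (fun q u => f (q, u)))) => V oV Vx.
apply: contrapT => nou; apply: no; exists V; split=> // u Vu pu ux.
apply: contrapT => noJ; apply: nou; exists u; split=> // J idJ lubJ Jp.
apply: contrapT => noq; apply: noJ; exists J; split=> // q Jq.
apply: contrapT => nlost; apply: noq; exists q => //.
by apply: (fP (q, u)) => //=; exact: lubJ.1.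
Qed.

(** The bad ideals are nested: [y] is taken from one with supremum [x], [q] from one with supremum
    [y], and [p] lies in one with supremum [q]. As [Stop] does not win at [(q, y)], [q] differs from
    [y]. *)
Lemma lost_split p x : lost p x ->
  exists q y, [/\ lost p q, lost y x, p <= y, q <= x & q < y].
Proof.
move=> lpx; have [px _] := lpx; have [V [oV Vx VP]] := lost_ideal lpx.
have [J [[dirJ lowJ] lubJ Jp lJ]] := VP _ Vx px (lexx _).
have [a [Ja Va]] := oV.2 _ _ dirJ lubJ Vx.
have [y [Jy ay py]] := dirJ.2 _ _ Ja Jp.
have Vy : V y by exact: oV.1 ay.
have yx : y <= x by exact: lubJ.1.
have [K [[dirK lowK] lubK Kp lK]] := VP _ Vy py yx.
have [b [Kb Vb]] := oV.2 _ _ dirK lubK Vy.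
have [q [Kq bq pq]] := dirK.2 _ _ Kb Kp.
have Vq : V q by exact: oV.1 bq.
have qy : q <= y by exact: lubK.1.
have [L [_ _ Lp lL]] := VP _ Vq pq (le_trans qy yx).
exists q, y; split=> //; [exact: lL|exact: lJ|exact: le_trans yx|].
rewrite lt_neqAle qy andbT; apply/eqP => qE.
by have [_ /(_ Stop)] := lK _ Kq; rewrite qE; apply.
Qed.

(* Splitting lost intervals repeatedly, each time keeping a half that misses
   the next point in an enumeration, leaves a supremum that is not enumerated. *)
Lemma countable_dcpo_wins : countable [set: P] -> dcpo P ->
  forall p x, p <= x -> exists t, wins t p x.
Proof.
move=> /countable_injP[c cinj] P_dcpo p x px.
apply: contrapT => nwin.
have l0 : lost p x by split=> // t tw; apply: nwin; exists t.
pose T := {a : P * P | lost a.1 a.2}.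
have step (k : nat) (a : T) : exists b : T, [/\ (sval a).1 <= (sval b).1,
    (sval b).2 <= (sval a).2 &
    forall z, c z = k -> (sval b).1 <= z -> z <= (sval b).2 -> False].
  case: a => -[p1 x1] /= l1.
  have [q [y [lpq lyx py qx qy]]] := lost_split l1.
  have [[z [zk yz]]|no] := pselect (exists z, c z = k /\ y <= z).
    exists (exist _ (p1, q) lpq); split=> //= z' z'k _ z'q.
    have zz' : z' = z by apply: cinj; rewrite ?inE // z'k.
    rewrite zz' in z'q.
    by have := lt_le_trans qy (le_trans yz z'q); rewrite ltxx.
  by exists (exist _ (y, x1) lyx); split=> //= z zk yz _; apply: no; exists z.
have /choice[f fP] (ka : nat * T) := step ka.1 ka.2.
pose s := fix s k : T :=
  if k is k'.+1 then f (k', s k') else exist _ (p, x) l0.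
have sS k : [/\ (sval (s k)).1 <= (sval (s k.+1)).1,
    (sval (s k.+1)).2 <= (sval (s k)).2 &
    forall z, c z = k -> (sval (s k.+1)).1 <= z -> z <= (sval (s k.+1)).2 -> False].
  exact: (fP (k, s k)).
have lo_mono : {homo (fun k => (sval (s k)).1) : j k / (j <= k)%N >-> j <= k}.
  apply: (@homo_leq _ _ (fun a b => a <= b)) => // [? ? ?|k].
    exact: le_trans.
  by case: (sS k).
have hi_mono : {homo (fun k => (sval (s k)).2) : j k / (j <= k)%N >-> k <= j}.
  apply: (@homo_leq _ _ (fun a b => b <= a)) => // [b a b' ab bb'|k].
    exact: le_trans ab.
  by case: (sS k).
have [|z [ubz lubz]] := P_dcpo (range (fun k => (sval (s k)).1)).
  split; first by exists (sval (s 0)).1, 0%N.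
  move=> _ _ [j _ <-] [k _ <-]; exists (sval (s (maxn j k))).1.
  by split; [exists (maxn j k)|exact/lo_mono/leq_maxl|exact/lo_mono/leq_maxr].
(* [z] lies in every interval, including the one chosen to avoid the point with code [c z]. *)
have [_ _ /(_ z erefl)] := sS (c z); apply.
  by apply: ubz; exists (c z).+1.
apply: lubz => _ [k _ <-].
have [lk _] := svalP (s (maxn k (c z).+1)).
apply: (le_trans (lo_mono _ _ (leq_maxl k (c z).+1))).
by apply: (le_trans lk); apply: hi_mono; exact: leq_maxr.
Qed.

End Ideals.

(** * Open boxes in a finite product *)

Section Product.
Context {d : Order.disp_t} {I : finType} (P : I -> porderType d).

Lemma scott_open_section (U : set (poset_prod P)) (y : poset_prod P) (i : I) :
  scott_open U -> @open (scott (P i)) [set v | U (dfwith y i v)].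
Proof.
move=> [Uup US]; split=> [v w Uv vw|D s dirD [ubs lubs] Us].
  apply: Uup Uv _; apply/asboolP => j.
  by case: dfwithP => [|k ik]; rewrite ?dfwithin ?dfwithout.
have [||_ [[v Dv <-] Uv]] :=
  US [set dfwith y i v | v in D] (dfwith y i s) _ _ Us.
- split; first by case: dirD => -[v Dv] _; exists (dfwith y i v), v.
  move=> _ _ [v Dv <-] [w Dw <-]; have [z [Dz vz wz]] := dirD.2 _ _ Dv Dw.
  exists (dfwith y i z); split; first by exists z.
    by apply/asboolP => j; case: dfwithP => [|k ik]; rewrite ?dfwithin ?dfwithout.
  by apply/asboolP => j; case: dfwithP => [|k ik]; rewrite ?dfwithin ?dfwithout.
- split=> [_ [v Dv <-]|b ubb].
    apply/asboolP => j; case: dfwithP => [|k ik]; last by rewrite dfwithout.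
    by rewrite dfwithin; exact: ubs.
  have le_b v : D v -> forall j, dfwith y i v j <= b j.
    by move=> Dv; apply/asboolP; apply: ubb; exists v.
  apply/asboolP => j; case: dfwithP => [|k ik].
    by apply: lubs => v /le_b/(_ i); rewrite dfwithin.
  by have [[v /le_b/(_ k)]] := dirD; rewrite dfwithout.
- by exists v.
Qed.

Context (P_countable : forall i, countable [set: P i])
  (P_dcpo : forall i, dcpo (P i))
  (P_mc : forall i, meet_continuous (P i))
  (P_sups : forall i (r : P i) (A : set (pideal r)),
    A !=set0 -> exists s : pideal r, isLub A s).

Section OpenBox.
Context (U : set (poset_prod P)) (x0 : poset_prod P).
Context (oU : scott_open U) (Ux0 : U x0).

(* Attaching strategies to the points, rather than choosing one strategy per
   pair, lets a point chosen by a strategy inherit the remaining strategies;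
   this is what makes the induction in [hits] below well-founded. *)
Let entry : Type := (poset_prod P * (forall i, P i -> strategy (P i)))%type.

Let winning (e : entry) := forall i p, p <= e.1 i -> wins (e.2 i p) p (e.1 i).

Lemma exists_winning (y : poset_prod P) : exists e : entry, e.1 = y /\ winning e.
Proof.
have ex i p : exists t, p <= y i -> wins t p (y i).
  have [/(countable_dcpo_wins (@P_countable i) (@P_dcpo i))[t tw]|np] :=
    pselect (p <= y i); first by exists t.
  by exists (Stop _).
exists (y, fun i p => sval (cid (ex i p))); split=> // i p.
exact: (svalP (cid (ex i p))).
Qed.

Lemma open_box : exists O : forall i, set (P i),
  [/\ forall i, @open (scott (P i)) (O i), forall i, O i (x0 i) &
      forall y : poset_prod P, (forall i, O i (y i)) -> U y].
Proof.
have [e0 [e0x0 e0win]] := exists_winning x0.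
have c_ex i : exists c : P i -> nat, injective c.
  have /countable_injP[c cinj] := P_countable i.
  by exists c => x y; apply: cinj; rewrite inE.
pose c i := sval (cid (c_ex i)).
have cinj i : injective (c i) := svalP (cid (c_ex i)).
(* A request names an entry, a factor and the code of a point; codes put the requests of all factors
   in one countable type. *)
have [sched schedP] := infinitely_repeating_enumeration (nat * I * nat)%type.
pose point (l : seq entry) (phi : I -> nat) : poset_prod P :=
  fun i => (nth e0 l (phi i)).1 i.
pose good (l : seq entry) := (forall m, winning (nth e0 l m)) /\
  forall phi, (forall i, (phi i < size l)%N) -> U (point l phi).
pose answers (i : I) (p : P i) (u : P i) (g : P i -> P i -> strategy (P i))
    (e : entry) := [/\ p <= e.1 i, e.1 i <= u &
  forall J, ideal J -> isLub J (e.1 i) -> J p ->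
    exists2 p', J p' & e.2 i p' = g p' (e.1 i)].
pose next (l : seq entry) (e : entry) := (size l = 0 -> e = e0) /\
  forall (m : nat) i (p : P i) g, sched (size l) = Some (m, i, c i p) -> (m < size l)%N ->
    p <= (nth e0 l m).1 i -> (nth e0 l m).2 i p = Play g ->
    answers i p ((nth e0 l m).1 i) g e.
have good0 : good [::].
  split=> [m|phi _]; first by rewrite nth_nil.
  suff -> : point [::] phi = x0 by [].
  by rewrite -e0x0; apply: functional_extensionality_dep => i; rewrite /point nth_nil.
have good_rcons l m e : good l -> (m < size l)%N -> winning e ->
    (exists i v, e.1 = dfwith (nth e0 l m).1 i v /\
      forall phi, (forall j, (phi j < size l)%N) -> U (dfwith (point l phi) i v)) ->
    good (rcons l e).
  move=> [lwin lU] ml ewin [i [v [ev Uv]]]; split=> [k|phi phil].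
    by rewrite nth_rcons; case: ifP => // _; case: ifP.
  (* Off coordinate [i] the new entry agrees with entry [m], so only coordinate [i] can leave the
     old box. *)
  pose psi j := if (phi j < size l)%N then phi j else m.
  have psil j : (psi j < size l)%N by rewrite /psi; case: ifP.
  have psiE j : j != i \/ (phi j < size l)%N ->
      point (rcons l e) phi j = point l psi j.
    rewrite /point /psi nth_rcons; case: ifP => // nlt [ji|//].
    have -> : phi j == size l.
      by have := phil j; rewrite size_rcons ltnS leq_eqVlt nlt orbF.
    by rewrite ev dfwithout // eq_sym.
  have [ltl|nlt] := boolP (phi i < size l)%N.
    suff -> : point (rcons l e) phi = point l psi by exact: lU.
    apply: functional_extensionality_dep => j; apply: psiE.
    by have [->|] := eqVneq j i; [right|left].
  suff -> : point (rcons l e) phi = dfwith (point l psi) i v by exact: Uv.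
  apply: functional_extensionality_dep => j; case: dfwithP => [|k ik].
    rewrite /point nth_rcons (negbTE nlt).
    have -> : phi i == size l.
      by have := phil i; rewrite size_rcons ltnS leq_eqVlt (negbTE nlt) orbF.
    by rewrite ev dfwithin.
  by apply: psiE; left; rewrite eq_sym.
have good_next l : good l -> exists e, good (rcons l e) /\ next l e.
  move=> gl; have [l0|l0] := posnP (size l).
    exists e0; rewrite (size0nil l0); split; last first.
      by split=> // m i p g _; rewrite ltn0.
    split=> [m|phi _] /=; first by case: m => [|m] //=; rewrite nth_nil.
    suff -> : point [:: e0] phi = x0 by [].
    rewrite -e0x0; apply: functional_extensionality_dep => i; rewrite /point.
    by case: (phi i) => //= m; rewrite nth_nil.
  (* When no request applies, repeating an entry leaves the box unchanged. *)
  have repeat : good (rcons l (nth e0 l 0)).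
    split=> [m|phi phil].
      rewrite nth_rcons; case: ifP => _; first exact: gl.1.
      by case: ifP => // _; exact: gl.1.
    pose psi j := if (phi j < size l)%N then phi j else 0%N.
    suff -> : point (rcons l (nth e0 l 0)) phi = point l psi.
      by apply: gl.2 => j; rewrite /psi; case: ifP.
    apply: functional_extensionality_dep => j.
    rewrite /point /psi nth_rcons; case: ifP => // nlt.
    have -> // : phi j == size l.
    by have := phil j; rewrite size_rcons ltnS leq_eqVlt nlt orbF.
  have [[m [i [p [g [schedE ml pu tE]]]]]|no] := pselect (exists (m : nat) i (p : P i) g,
    [/\ sched (size l) = Some (m, i, c i p), (m < size l)%N,
      p <= (nth e0 l m).1 i & (nth e0 l m).2 i p = Play g]); last first.
    exists (nth e0 l 0); split=> //; split=> [ls|m i p g h1 h2 h3 h4].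
      by rewrite ls in l0.
    by exfalso; apply: no; exists m, i, p, g.
  (* The values at [i] that keep the whole box in [U]; the box is finite, so this is a finite
     intersection of open sections. *)
  pose V := [set v | forall phi : {ffun I -> 'I_(size l)},
    U (dfwith (point l (fun j => phi j)) i v)].
  have oV : @open (scott (P i)) V.
    rewrite openE => v Vv.
    apply: (@filter_forall (scott (P i)) _ (fun phi : {ffun I -> 'I_(size l)} =>
      [set w | U (dfwith (point l (fun j => phi j)) i w)])
      (nbhs (v : scott (P i))) _) => phi.
    apply: open_nbhs_nbhs; split; last exact: Vv.
    exact: scott_open_section.
  have Vu : V ((nth e0 l m).1 i).
    move=> phi.
    suff -> : dfwith (point l (fun j => phi j)) i ((nth e0 l m).1 i) =
        point l (fun j => if j == i then m else phi j).
      by apply: gl.2 => j; case: ifP.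
    apply: functional_extensionality_dep => j.
    case: dfwithP => [|k ik]; first by rewrite /point eqxx.
    by rewrite /point eq_sym (negbTE ik).
  have := gl.1 m i p pu; rewrite tE => /(_ V oV Vu)[v [Vv pv vu vP]].
  have [e1 [e1v e1win]] := exists_winning (dfwith (nth e0 l m).1 i v).
  (* Inherit the continuation of [g] wherever it wins, and use a fresh winning strategy
     elsewhere. *)
  pose f := e1.2; pose f' := dfwith f i (fun p' =>
    if pselect (wins (g p' v) p' v) then g p' v else f i p').
  pose e : entry := (e1.1, f').
  have ev : e.1 i = v by rewrite /= e1v dfwithin.
  have ewin : winning e.
    move=> j; rewrite /e /= /f'; case: dfwithP => [|k ik] q qle.
      case: pselect => [w|_] /=; last exact: e1win.
      by rewrite e1v dfwithin.
    exact: e1win.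
  exists e; split.
    apply: (@good_rcons l m) => //; exists i, v; split=> // phi phil.
    have := Vv [ffun j => Ordinal (phil j)].
    congr (U (dfwith _ i v)).
    by apply: functional_extensionality_dep => j; rewrite /point ffunE.
  split=> [ls|m' i' p' g']; first by rewrite ls in l0.
  rewrite schedE => -[<-] ii'; move: p' g'; rewrite -ii' => p' g'.
  move=> /cinj <- _ _; rewrite tE => -[<-].
  split; rewrite ev // => J idJ lubJ Jp.
  have [q Jq qw] := vP J idJ lubJ Jp; exists q => //.
  by rewrite /e /f' /= dfwithin; case: pselect.
have [e eP] := course_of_values_choice e0 good0 good_next.
have ewin k : winning (e k).
  have [[+ _] _] := eP k.+1; move=> /(_ k); rewrite nth_mkseq //.
have e0E : e 0%N = e0 by have [_ [+ _]] := eP 0%N; apply.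
(* Induction on the strategy: a later entry [m] answers the request, [J] is cut at its coordinate,
   and a reply [p'] in the cut carries a subtree. At [Stop], [p] is itself the coordinate. *)
have hits i (t : strategy (P i)) k p : p <= (e k).1 i -> (e k).2 i p = t ->
    forall J, ideal J -> isLub J ((e k).1 i) -> J p ->
    exists k', J ((e k').1 i).
  elim: t k p => [|g IH] k p pu tE J idJ lubJ Jp.
    by exists k; have := ewin k i p pu; rewrite tE /= => <-.
  have [m km mE] := schedP (k, i, c i p) k.+1.
  have [_ [_ /(_ k i p g)]] := eP m.
  rewrite size_mkseq nth_mkseq // => /(_ mE km pu tE) [pv vu vP].
  have [idK lubK] :=
    ideal_meet_principal (@P_dcpo i) (@P_mc i) (@P_sups i) idJ lubJ vu.
  have [p' [Jp' p'v] p'E] := vP _ idK lubK (conj Jp pv).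
  by have [k' []] := IH _ _ m p' p'v p'E _ idK lubK (conj Jp' p'v); exists k'.
exists (fun i => [set v | exists k, (e k).1 i <= v]); split=> [i|i|y yO].
- split=> [v w [k kv] vw|D s dirD lubD [k ks]].
    by exists k; exact: le_trans vw.
  have [idK lubK] := ideal_meet_principal (@P_dcpo i) (@P_mc i) (@P_sups i)
    (ideal_down dirD) (isLub_down lubD) ks.
  have [[p Kp] _] := idK.1.
  have [k' [[z [Dz k'z]] _]] := hits i _ k p Kp.2 erefl _ idK lubK Kp.
  by exists z; split=> //; exists k'.
- by exists 0%N; rewrite e0E e0x0.
(* Finitely many coordinates use finitely many entries, all present after the largest index. *)
- have [phi phiP] := fin_all_exists yO.
  have [[_ /(_ phi)]] := eP (\max_i phi i).+1.
  rewrite size_mkseq => UN _; apply: oU.1 (UN _) _.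
    by move=> i; rewrite ltnS leq_bigmax.
  by apply/asboolP => i; rewrite /point nth_mkseq // ltnS leq_bigmax.
Qed.

End OpenBox.
End Product.

(** * Comparison of the two topologies *)

Lemma product_open_scott_open (d : Order.disp_t) (I : eqType)
    (P : I -> porderType d) (A : set (poset_prod P)) :
  product_of_scott_topologies P A -> scott_topology (poset_prod P) A.
Proof.
suff /continuousP : continuous
    (id : scott (poset_prod P) -> prod_topology (fun i => scott (P i))) by apply.
move=> x; have Fx : Filter (id @ nbhs (x : scott (poset_prod P))) by exact: fmap_filter.
apply/(cvg_sup _ _ Fx) => i B.
rewrite (@nbhsE (initial_topology (fun f : forall i, scott (P i) => f i))).
move=> [_ [[C oC <-] Cx] CB]; apply: filterS CB _.
apply: open_nbhs_nbhs; split=> // {Cx}.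
split=> [y z Cy /asboolP yz|D s dirD [ubs lubs] Cs].
  by apply: oC.1 Cy _.
have [||_ [[y Dy <-] Cy]] := oC.2 [set y i | y in D] (s i) _ _ Cs.
- split; first by case: dirD => -[y Dy] _; exists (y i), y.
  move=> _ _ [y Dy <-] [z Dz <-].
  have [w [Dw /asboolP yw /asboolP zw]] := dirD.2 _ _ Dy Dz.
  by exists (w i); split=> //; exists w.
- split=> [_ [y /ubs/asboolP ys <-]|b ubb]; first exact: ys.
  (* Replacing coordinate [i] of [s] by [b] gives another upper bound of [D], so leastness of [s]
     bounds [s i] by [b]. *)
  suff /asboolP/(_ i) : s <= (dfwith (s : forall j, P j) i b : poset_prod P).
    by rewrite dfwithin.
  apply: lubs => y Dy; apply/asboolP => j.
  case: dfwithP => [|k ik]; first by apply: ubb; exists y.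
  by have /asboolP := ubs _ Dy.
- by exists y.
Qed.

Theorem corollary4p2 (n : nat) (d : Order.disp_t) (P : 'I_n -> porderType d)
    (P_nonempty : forall i, [set: P i] !=set0)
    (P_countable : forall i, countable [set: P i])
    (P_dcpo : forall i, dcpo (P i))
    (P_meet_continuous : forall i, meet_continuous (P i))
    (P_ideal_sups : forall (i : 'I_n) (r : P i) (A : set (pideal r)),
        A !=set0 -> exists s : pideal r, isLub A s) :
  scott_topology (poset_prod P) = product_of_scott_topologies P.
Proof.
apply/seteqP; split=> [U oU|U]; last exact: product_open_scott_open.
rewrite /product_of_scott_topologies openE => x Ux.
have [O [oO Ox OU]] := open_box P_countable P_dcpo P_meet_continuous
  P_ideal_sups oU Ux.
pose T : topologicalType := prod_topology (fun i => scott (P i)).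
apply: (@filterS T (nbhs (x : T)) _ [set y | forall i, O i (y i)]) => //.
apply: (@filter_forall T _ (fun i => [set y : T | O i (y i)]) (nbhs (x : T)) _).
move=> i.
apply: (@proj_continuous _ (fun i => scott (P i)) i x).
by apply: open_nbhs_nbhs.
Qed.
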